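(* Let $\Psi$ contain the coordinate functions, i.e. $\Psi(x) = (x^\top, \bar\Psi(x)^\top)^\top \in \mathbb{R}^N$. Then the matrix $$C := \begin{pmatrix} I_d & 0_{d\times (N-d)} \\ 0_{(N-d)\times d} & 0_{(N-d)\times (N-d)} \end{pmatrix} \in \mathbb{R}^{N\times N}$$ induces a Riemannian metric on $M$, and the coordinate projection $\pi:\mathbb{R}^N\to M$ coincides with the closest-point projection $\pi_W:\mathbb{R}^N\to M$ with $W = C$, i.e. $$\pi_C(z) = \pi(z) = \big(z_{[1:d]}, \bar\Psi(z_{[1:d]})\big) \qquad \text{for all } z \in \mathbb{R}^N.$$
   Context: Let $\mathbb{X} \subset \mathbb{R}^d$ be compact and $D := \{x+y : x \in \mathbb{X},\ \|y\| < \eta\}$ for some (sufficiently large) $\eta > 0$, where $\|\cdot\|$ is the Euclidean norm. Let $\psi_1,\dots,\psi_N \in L^2(D,\mathbb{R})$ be linearly independent observables and $\Psi(x) = (\psi_1(x),\dots,\psi_N(x))^\top$. That $\Psi$ contains the coordinate functions means $\psi_i(x) = x_i$ for $i = 1,\dots,d$; then $\bar\Psi := (\psi_{d+1},\dots,\psi_N)^\top : \mathbb{R}^d \to \mathbb{R}^{N-d}$ denotes the remaining components, assumed to be smooth. $\mathrm{D}\Psi(x) \in \mathbb{R}^{N\times d}$ denotes the differential of $\Psi$ at $x$. Set $M := \{\Psi(x) : x \in \mathbb{X}\} \subset \mathbb{R}^N$, assumed to be a smooth $d$-dimensional embedded manifold in $\mathbb{R}^N$ (continuous differentiability is sufficient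 smoothness). For $z \in \mathbb{R}^N$, $z_{[1:d]} \in \mathbb{R}^d$ denotes the vector of its first $d$ entries. The coordinate projection $\pi : \mathbb{R}^N \to M$ is defined by $\pi(z) := (z_{[1:d]}, \bar\Psi(z_{[1:d]})) \in M$ for all $z \in \mathbb{R}^N$. For a symmetric positive semi-definite matrix $W \in \mathbb{R}^{N\times N}$, let $\langle u_1,u_2\rangle_W := u_1^\top W u_2$ be the weighted semi-inner product on $\mathbb{R}^N$ and $\|u\|_W := \sqrt{u^\top W u}$ the associated semi-norm. If $\det(\mathrm{D}\Psi(x)^\top W\, \mathrm{D}\Psi(x)) \neq 0$ for all $x \in \mathbb{X}$ (in particular, if $W$ is invertible), then $W$ induces a Riemannian metric on $M$. For $W$ satisfying this determinant condition, the closest-point projection $\pi_W : \mathbb{R}^N \to M$ is defined as $\pi_W(z) := \operatorname{argmin}_{p \in M} \|z-p\|_W$.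
   Formalization: The identity π_C(z) = π(z) is stated only for those z with π(z) ∈ M (i.e. z_[1:d] ∈ X), since for compact X the point π(z) leaves M for other z and the claim fails there; M is also allowed to have boundary and corners. *)

(* Defs.v *)
(* MathComp / MathComp-Analysis; vectors of R^n are columns 'cV[R]_n. *)
From HB Require Import structures.
From mathcomp Require Import all_boot all_order all_algebra.
From mathcomp Require Import all_classical all_reals all_analysis.

Set Implicit Arguments.
Unset Strict Implicit.
Unset Printing Implicit Defensive.

Import Order.TTheory GRing.Theory Num.Theory.
Import numFieldNormedType.Exports.

Local Open Scope classical_set_scope.
Local Open Scope ring_scope.

Definition of_outer (R : realType) (T : pointedType)
    (mu : {outer_measure set T -> \bar R}) :
    {measure set (caratheodory_type mu) -> \bar R} := mu.

(* Lebesgue measure on R^n: the Caratheodory measure of the outer measure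
   inf { \sum_k |B_k| : A included in \bigcup_k B_k, B_k half-open boxes }. *)
Section lebesgue_measure_Rn.
Variables (R : realType) (n : nat).

Definition box (a b : 'cV[R]_n) : set 'cV[R]_n :=
  [set x | forall i, a i 0 < x i 0 <= b i 0].

(* Sets that are not boxes get volume +oo (infimum of the empty set), so they
   never contribute to a cover of finite volume.  The empty set is treated
   apart because of n = 0, where the only box is a point, of volume 1. *)
Definition box_volume (A : set 'cV[R]_n) : \bar R :=
  if `[< A = set0 >] then 0%E
  else ereal_inf [set (\prod_(i < n) (ab.2 i 0 - ab.1 i 0))%:E
                 | ab in [set ab : 'cV[R]_n * 'cV[R]_n |
                           (forall i, ab.1 i 0 <= ab.2 i 0) /\
                           A = box ab.1 ab.2]].

Lemma box_volume0 : box_volume set0 = 0%E.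
Proof. by rewrite /box_volume asboolT. Qed.

Lemma box_volume_ge0 A : (0 <= box_volume A)%E.
Proof.
rewrite /box_volume; case: ifP => // _.
apply: le_ereal_inf_tmp => _ [[a b] /= [ab _] <-].
by rewrite lee_fin prodr_ge0// => i _; rewrite subr_ge0.
Qed.

(* [mu_ext] is used over the discrete sigma-algebra, which puts no
   measurability constraint on the covering sets. *)
Local Notation discrete_Rn := (g_sigma_algebraType [set: set 'cV[R]_n]).

Definition lebesgue_outer (A : set 'cV[R]_n) : \bar R :=
  @mu_ext _ discrete_Rn R box_volume A.

HB.instance Definition _ := isOuterMeasure.Build R 'cV[R]_n lebesgue_outer
  (@mu_ext0 _ discrete_Rn R _ box_volume0 box_volume_ge0)
  (@mu_ext_ge0 _ discrete_Rn R _ box_volume_ge0)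
  (@le_mu_ext _ discrete_Rn R _)
  (@mu_ext_sigma_subadditive _ discrete_Rn R _ box_volume_ge0).

Definition lebesgue_Rn :
    {measure set (caratheodory_type lebesgue_outer) -> \bar R} :=
  of_outer lebesgue_outer.

(* D is meant to be measurable, so f is in L^2(D) iff its extension by zero is
   in L^2(R^n). *)
Definition in_L2 (D : set 'cV[R]_n) (f : 'cV[R]_n -> R) : Prop :=
  (f \_ D : caratheodory_type lebesgue_outer -> R)
    \in Lfun lebesgue_Rn 2%:E.

Definition lin_indep_L2 (D : set 'cV[R]_n) p (F : 'cV[R]_n -> 'cV[R]_p) :
    Prop :=
  forall c : 'I_p -> R,
    {ae lebesgue_Rn, forall x, D x -> \sum_i c i * F x i 0 = 0} ->
    forall i, c i = 0.

End lebesgue_measure_Rn.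

Section weighted.
Variables (R : realType) (n : nat).
Implicit Types (W : 'M[R]_n) (u v z p q : 'cV[R]_n).

Definition wdot W u v : R := (u^T *m W *m v) 0 0.

Definition wnorm W u : R := Num.sqrt (wdot W u u).

Definition enorm u : R := wnorm 1%:M u.

Definition sym_psd W : Prop := W^T = W /\ forall u, 0 <= wdot W u u.

(* Set-valued argmin: "argmin = p" reads [closest_points W M z = [set p]]. *)
Definition closest_points W (M : set 'cV[R]_n) z : set 'cV[R]_n :=
  [set p | M p /\ forall q, M q -> wnorm W (z - p) <= wnorm W (z - q)].

Definition thickening (X : set 'cV[R]_n) (eta : R) : set 'cV[R]_n :=
  [set x + y | x in X & y in [set y | enorm y < eta]].

End weighted.

Section C1.
Variables (R : realType) (n p : nat).

Definition Dmx (f : 'cV[R]_n -> 'cV[R]_p) (x : 'cV[R]_n) : 'M[R]_(p, n) :=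
  \matrix_(i, j) ('d f x (delta_mx j 0 : 'cV[R]_n)) i 0.

(* Meant for open U. *)
Definition C1_on (U : set 'cV[R]_n) (f : 'cV[R]_n -> 'cV[R]_p) : Prop :=
  forall x, U x -> differentiable f x /\ {for x, continuous (Dmx f)}.

End C1.

(* Embedded d-dimensional C^1 submanifolds of R^(d + m), corners allowed.
   A nonempty compact graph over a subset of R^d, d > 0, cannot be a
   d-dimensional manifold without boundary. *)
Section manifold.
Variables (R : realType) (d m : nat).
Local Notation E := 'cV[R]_(d + m).

(* The local model { y : y_i >= 0 for i in S, y_j = 0 for j > d }: no boundary
   if S is empty, a smooth boundary if #|S| = 1, a corner otherwise. *)
Definition corner_model (S : {set 'I_d}) : set E :=
  [set y : E | (forall i, i \in S -> 0 <= y (lshift m i) 0) /\ dsubmx y = 0].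

Definition flattening_chart (M U V : set E) (S : {set 'I_d})
    (phi psi : E -> E) : Prop :=
  [/\ open U /\ open V,
      C1_on U phi /\ C1_on V psi,
      forall x, U x -> V (phi x) /\ psi (phi x) = x,
      forall y, V y -> U (psi y) /\ phi (psi y) = y
    & forall x, U x -> (M x <-> corner_model S (phi x))].

Definition embedded_manifold (M : set E) : Prop :=
  forall p, M p -> exists U V S phi psi,
    flattening_chart M U V S phi psi /\ U p.

(* The full d-dimensional tangent space, also at boundary points. *)
Definition tangent_space (M : set E) (p : E) : set E :=
  [set u | M p /\ exists U V S phi psi,
     [/\ flattening_chart M U V S phi psi, U p
       & dsubmx ('d phi p u : E) = 0]].

(* On a C^1 manifold the coefficients of a metric in charts are continuous. *)
Definition riemannian_metric (M : set E) (g : E -> E -> E -> R) : Prop :=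
  (forall p, M p ->
    [/\ forall u v, tangent_space M p u -> tangent_space M p v ->
          g p u v = g p v u,
        forall (a : R) u v w, tangent_space M p u -> tangent_space M p v ->
          tangent_space M p w -> g p (a *: u + v) w = a * g p u w + g p v w
      & forall u, tangent_space M p u -> u != 0 -> 0 < g p u u]) /\
  (forall U V S phi psi, flattening_chart M U V S phi psi ->
    forall i j : 'I_d,
    {within V `&` corner_model S, continuous (fun y =>
       g (psi y) ('d psi y (delta_mx (lshift m i) 0 : E))
                 ('d psi y (delta_mx (lshift m j) 0 : E)))}).

Definition induces_metric (W : 'M[R]_(d + m)) (M : set E) : Prop :=
  riemannian_metric M (fun _ => wdot W).

End manifold.

Section coordinate_projection.
Variables (R : realType) (d m : nat).
Variable Psi : 'cV[R]_d -> 'cV[R]_(d + m).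

Definition Psibar (x : 'cV[R]_d) : 'cV[R]_m := dsubmx (Psi x).

Definition contains_coordinates : Prop :=
  forall x, Psi x = col_mx x (Psibar x).

Definition coord_proj (z : 'cV[R]_(d + m)) : 'cV[R]_(d + m) :=
  col_mx (usubmx z) (Psibar (usubmx z)).

End coordinate_projection.

Definition Cmx (R : realType) (d m : nat) : 'M[R]_(d + m) :=
  block_mx 1%:M 0 0 0.

(* Main.v *)
Require Import Defs.
From HB Require Import structures.
From mathcomp Require Import all_boot all_order all_algebra.
From mathcomp Require Import all_classical all_reals all_analysis.

Set Implicit Arguments.
Unset Strict Implicit.
Unset Printing Implicit Defensive.

Import Order.TTheory GRing.Theory Num.Theory.
Import numFieldNormedType.Exports.

Local Open Scope classical_set_scope.
Local Open Scope ring_scope.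

(** Why the statement holds.  Since C keeps the first d coordinates and kills
    the others, its form is <u, v>_C = <u_[1:d], v_[1:d]>, the Euclidean product
    of the upper blocks ([gram_Cmx], [wdot_Cmx]).

    The upper block of Psi is the identity, hence so is that of its differential
    ([usubmx_Dmx_Psi]), and D Psi^T C D Psi = I_d has determinant 1.

    For the metric, only definiteness on tangent vectors needs an argument.  The
    set M = Psi(X) lies on the graph of Psibar, so the map
    z |-> z_[d+1:N] - Psibar(z_[1:d]) vanishes on M, and its differential then
    kills every tangent vector u ([tangent_diff_eq0]).  This says that
    u_[d+1:N] = D Psibar (u_[1:d]) ([tangent_graph]); a tangent vector with
    vanishing upper block is therefore zero, and <u, u>_C > 0 whenever u != 0
    ([wdot_Cmx_tangent_gt0]).  At a corner or boundary point, M contains in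
    general no curve with velocity u through the point; what is available is
    that in a chart each coordinate direction e_i, i <= d, points into the
    model, and a function that is constant along a ray has zero differential in
    the direction of that ray ([diff_const_on_ray]).  The e_i span the tangent
    directions of the chart, which suffices by linearity.

    As for the projections, z and pi(z) share their first d coordinates, so pi(z)
    is at C-distance 0 from z.  A point of M at C-distance 0 from z is a Psi(x)
    with x = z_[1:d], that is, pi(z) itself ([closest_points_Cmx]). *)

(** * Pointwise rules for differentials *)

Lemma open_near_ray (R : numFieldType) (V : normedModType R) (U : set V) (p v : V) :
  open U -> U p -> \forall t \near 0^'+, U (t *: v + p).
Proof.
move=> Uo Up.
have : \forall x \near 0, U (x + p).
  have : \forall x \near p, U x by exact: open_nbhs_nbhs.
  by rewrite (near_shift 0 p) /= subr0.
move=> /(near0Z v) nU.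
by near=> t; near: t; apply: cvg_within; exact: nU.
Unshelve. all: by end_near. Qed.

(** Differentiability makes the two-sided directional derivative exist, so it can
    be computed from the right, along the ray alone. *)
Lemma diff_const_on_ray (R : numFieldType) (V W : normedModType R) (f : V -> W)
    (p v : V) : differentiable f p ->
  (\forall t \near 0^'+, f (t *: v + p) = f p) -> 'd f p v = 0.
Proof.
move=> fp cst_ray; rewrite -deriveE//.
have /cvg_at_rightE dE := @diff_derivable _ _ _ f p v fp.
rewrite /derive dE; apply: cvg_lim => //.
apply: cvg_near_cst; near=> t.
have fE : f (t *: v + p) = f p by near: t.
by rewrite /= fE subrr scaler0.
Unshelve. all: by end_near. Qed.

Lemma diff_compE (R : numFieldType) (U V W : normedModType R) (f : U -> V)
    (g : V -> W) (x v : U) :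
  differentiable f x -> differentiable g (f x) ->
  'd (g \o f) x v = 'd g (f x) ('d f x v).
Proof. by move=> fx gx; rewrite diff_comp. Qed.

Lemma diffBE (R : numFieldType) (U V : normedModType R) (f g : U -> V)
    (x v : U) :
  differentiable f x -> differentiable g x ->
  'd (f - g) x v = 'd f x v - 'd g x v.
Proof. by move=> fx gx; rewrite diffB. Qed.

Lemma diff_idE (R : numFieldType) (V : normedModType R) (x v : V) :
  'd (@id V) x v = v.
Proof. by have -> : 'd (@id V) x = id :> (V -> V) by exact: diff_val. Qed.

(** The map g \o f - id is differentiable at p and vanishes on short rays from p,
    so [diff_const_on_ray] applies to it. *)
Lemma diff_left_inverse (R : numFieldType) (U V : normedModType R) (A : set U)
    (f : U -> V) (g : V -> U) (p v : U) :
  open A -> A p -> (forall x, A x -> g (f x) = x) ->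
  differentiable f p -> differentiable g (f p) ->
  'd g (f p) ('d f p v) = v.
Proof.
move=> Ao Ap gf fp gp; apply/eqP; rewrite -subr_eq0; apply/eqP.
have gfp : differentiable (g \o f) p := differentiable_comp fp gp.
have idp : differentiable (@id U) p by exact: ex_diff.
rewrite -[X in _ - X](diff_idE p v) -diff_compE// -[LHS](diffBE v gfp idp).
apply: diff_const_on_ray; first exact: differentiableB.
have nA := open_near_ray v Ao Ap.
near=> t.
have gft : g (f (t *: v + p)) = t *: v + p by apply: gf; near: t.
by rewrite !fctE /= gft gf// !subrr.
Unshelve. all: by end_near. Qed.

(** The chain rule read through a chart f with inverse g: it moves the
    computation of 'd h to the model space, where rays are available. *)
Lemma diff_in_chart (R : numFieldType) (U V W : normedModType R) (A : set U)
    (f : U -> V) (g : V -> U) (h : U -> W) (p v : U) :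
  open A -> A p -> (forall x, A x -> g (f x) = x) ->
  differentiable f p -> differentiable g (f p) -> differentiable h p ->
  'd (h \o g) (f p) ('d f p v) = 'd h p v.
Proof.
move=> Ao Ap gf fp gp hp.
have hgp : differentiable h (g (f p)) by rewrite gf.
have := diff_compE ('d f p v) gp hgp.
by rewrite (diff_left_inverse v Ao Ap gf fp gp) (gf p Ap).
Qed.

(** * Linear maps on matrices and entries of differentials *)

(** Expanding in the basis of elementary matrices turns a linear map into a finite
    sum of coordinates times constants. *)
Lemma linear_mx_continuous (R : numFieldType) m n (W : normedModType R)
    (f : {linear 'M[R]_(m, n) -> W}) : continuous f.
Proof.
have -> : f = (fun A => \sum_i \sum_j A i j *: f (delta_mx i j)) :> (_ -> _).
  apply/funext => A; rewrite [in LHS](matrix_sum_delta A) linear_sum.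
  by apply: eq_bigr => i _; rewrite linear_sum; apply: eq_bigr => j _; rewrite linearZ.
apply: continuous_big => [|i _]; first exact: add_continuous.
apply: continuous_big => [|j _ A]; first exact: add_continuous.
by apply: cvgZr_tmp; [exact: nbhs_filter|exact: coord_continuous].
Qed.

Lemma differentiable_linear_mx (R : numFieldType) m n (W : normedModType R)
    (f : {linear 'M[R]_(m, n) -> W}) A : differentiable f A.
Proof. by apply: linear_differentiable; exact: linear_mx_continuous. Qed.

Lemma diff_linear_mx (R : numFieldType) m n (W : normedModType R)
    (f : {linear 'M[R]_(m, n) -> W}) A B : 'd f A B = f B.
Proof. by rewrite diff_lin//; exact: linear_mx_continuous. Qed.

Lemma continuous_diff_entry (R : realType) n p (f : 'cV[R]_n -> 'cV[R]_p)
    (x : 'cV[R]_n) a b :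
  {for x, continuous (Dmx f)} ->
  {for x, continuous (fun y => 'd f y (delta_mx b 0 : 'cV[R]_n) a 0)}.
Proof.
have -> : (fun y => 'd f y (delta_mx b 0 : 'cV[R]_n) a 0)
    = (fun A : 'M[R]_(p, n) => A a b) \o Dmx f.
  by apply/funext => y; rewrite /= mxE.
by move=> Df; exact: continuous_comp Df (@coord_continuous _ _ _ a b (Dmx f x)).
Qed.

(** * The tangent space annihilates every function that vanishes on the manifold *)

(** In a chart, F becomes a function that vanishes on the corner model.  From a
    point of the model, each of the rays along e_1, .., e_d stays in the model,
    because it raises one of the first d coordinates and fixes all others; hence
    the differential vanishes on the e_i, and so on their span, to which the
    image of u under the chart belongs. *)
Lemma tangent_diff_eq0 (R : realType) (d m : nat) (W : normedModType R)
    (M : set 'cV[R]_(d + m)) (F : 'cV[R]_(d + m) -> W) (p u : 'cV[R]_(d + m)) :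
  differentiable F p -> (forall q, M q -> F q = 0) -> tangent_space M p u ->
  'd F p u = 0.
Proof.
move=> Fp FM [Mp [U [V [S [phi [psi [[[Uo Vo] [phiC psiC] UV VU MS] Up tan_u]]]]]]].
have [Vp psiphi] := UV _ Up.
have [phip _] := phiC _ Up; have [psip _] := psiC _ Vp.
have Fpsi : differentiable F (psi (phi p)) by rewrite psiphi.
have Gp : differentiable (F \o psi) (phi p) by exact: differentiable_comp.
have Gcst y : V y -> corner_model S y -> F (psi y) = 0.
  move=> Vy Sy; have [Uy phiy] := VU _ Vy.
  by apply: FM; apply/(MS _ Uy); rewrite phiy.
have [corner_p dcorner_p] := (MS _ Up).1 Mp.
have G0 i : 'd (F \o psi) (phi p) (delta_mx (lshift m i) 0 : 'cV[R]_(d + m)) = 0.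
  apply: diff_const_on_ray => //.
  (* The ray stays in V only for small t, in the corner model for all t > 0. *)
  have nV := @open_near_ray _ _ _ _ (delta_mx (lshift m i) 0 : 'cV[R]_(d + m)) Vo Vp.
  near=> t.
  have t0 : 0 < t by near: t; exact: nbhs_right_gt.
  rewrite /= !Gcst//; first by near: t.
  split=> [k Sk|].
    by rewrite !mxE addr_ge0 ?corner_p// mulr_ge0 ?ler0n// ltW.
  apply/matrixP => a b; move/matrixP/(_ a b): dcorner_p; rewrite !mxE => ->.
  by rewrite eq_rlshift /= mulr0 addr0.
have leftinv x : U x -> psi (phi x) = x by move=> /UV[].
have <- := diff_in_chart u Uo Up leftinv phip psip Fp.
set w := 'd phi p u in tan_u *.
rewrite (matrix_sum_delta w) linear_sum big_split_ord/=.
rewrite !big1 ?addr0// => i _; rewrite big_ord1 linearZ/=.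
  by move/matrixP/(_ i 0): tan_u; rewrite !mxE => ->; rewrite scale0r.
by rewrite G0 scaler0.
Unshelve. all: by end_near. Qed.

(** * The semi-inner product of C *)

Section Cmx.
Variables (R : realType) (d m : nat).

Lemma mul_Cmx k (A : 'M[R]_(d + m, k)) : Cmx R d m *m A = col_mx (usubmx A) 0.
Proof.
by rewrite /Cmx -{1}[A]vsubmxK mul_block_col !mul0mx mul1mx !addr0.
Qed.

Lemma gram_Cmx k l (A : 'M[R]_(d + m, k)) (B : 'M[R]_(d + m, l)) :
  A^T *m Cmx R d m *m B = (usubmx A)^T *m usubmx B.
Proof.
rewrite -mulmxA mul_Cmx -{1}[A]vsubmxK tr_col_mx mul_row_col.
by rewrite mulmx0 addr0.
Qed.

Lemma wdot_Cmx (u v : 'cV[R]_(d + m)) :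
  wdot (Cmx R d m) u v = \sum_i u (lshift m i) 0 * v (lshift m i) 0.
Proof.
by rewrite /wdot gram_Cmx mxE; apply: eq_bigr => i _; rewrite !mxE.
Qed.

Lemma wdot_Cmx_ge0 (u : 'cV[R]_(d + m)) : 0 <= wdot (Cmx R d m) u u.
Proof. by rewrite wdot_Cmx sumr_ge0// => i _; rewrite -expr2 sqr_ge0. Qed.

Lemma wdot_Cmx_eq0 (u : 'cV[R]_(d + m)) :
  wdot (Cmx R d m) u u = 0 -> usubmx u = 0.
Proof.
rewrite wdot_Cmx => /psumr_eq0P u0; apply/matrixP => i j; rewrite ord1 !mxE.
apply/eqP; rewrite -sqrf_eq0 expr2 u0// => k _.
by rewrite -expr2 sqr_ge0.
Qed.

Lemma sym_psd_Cmx : sym_psd (Cmx R d m).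
Proof.
split; last exact: wdot_Cmx_ge0.
by rewrite /Cmx tr_block_mx !trmx0 trmx1.
Qed.

End Cmx.

(** * The image of Psi *)

Section graph.
Variables (R : realType) (d m : nat) (Psi : 'cV[R]_d -> 'cV[R]_(d + m)).
Hypothesis Psi_coord : contains_coordinates Psi.
Hypothesis Psibar_diff : forall x, differentiable (Psibar Psi) x.

Lemma usubmx_Psi x : usubmx (Psi x) = x.
Proof. by rewrite Psi_coord col_mxKu. Qed.

(** Psi x is the sum of the images of x and Psibar x under the two block
    inclusions, which are linear. *)
Lemma differentiable_Psi x : differentiable Psi x.
Proof.
have -> : Psi = (mulmx (col_mx 1%:M 0) \o id)
              + (mulmx (col_mx 0 1%:M) \o Psibar Psi).
  apply/funext => y; rewrite !fctE /= Psi_coord !mul_col_mx !mul1mx !mul0mx.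
  by rewrite add_col_mx addr0 add0r.
apply: differentiableD; apply: differentiable_comp => //.
  pose L : {linear 'cV[R]_d -> 'cV[R]_(d + m)} := mulmx (col_mx 1%:M 0).
  exact: (differentiable_linear_mx L).
pose L : {linear 'cV[R]_m -> 'cV[R]_(d + m)} := mulmx (col_mx 0 1%:M).
exact: (differentiable_linear_mx L).
Qed.

Lemma usubmx_diff_Psi x v : usubmx ('d Psi x v) = v.
Proof.
pose L : {linear 'cV[R]_(d + m) -> 'cV[R]_d} := usubmx.
have -> : usubmx ('d Psi x v) = 'd (L \o Psi) x v.
  rewrite (diff_compE v (differentiable_Psi x) (differentiable_linear_mx L _)).
  by rewrite diff_linear_mx.
have -> : L \o Psi = id by apply/funext => y; exact: usubmx_Psi.
exact: diff_idE.
Qed.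

Lemma usubmx_Dmx_Psi x : usubmx (Dmx Psi x) = 1%:M.
Proof.
apply/matrixP => i j.
have /matrixP/(_ i 0) := usubmx_diff_Psi x (delta_mx j 0).
by rewrite !mxE eqxx andbT => ->.
Qed.

(** Apply [tangent_diff_eq0] to z |-> dsubmx z - Psibar (usubmx z), a defining
    function of the graph that contains the manifold. *)
Lemma tangent_graph X p u : tangent_space (Psi @` X) p u ->
  dsubmx u = 'd (Psibar Psi) (usubmx p) (usubmx u).
Proof.
move=> tan_u.
pose Lu : {linear 'cV[R]_(d + m) -> 'cV[R]_d} := usubmx.
pose Ld : {linear 'cV[R]_(d + m) -> 'cV[R]_m} := dsubmx.
have Lu_diff := differentiable_linear_mx Lu p.
have Ld_diff := differentiable_linear_mx Ld p.
have Psi_diff := differentiable_comp Lu_diff (Psibar_diff (Lu p)).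
have vanish q : (Psi @` X) q -> ((Ld : _ -> _) - (Psibar Psi \o Lu)) q = 0.
  by move=> [x _ <-]; rewrite !fctE /= usubmx_Psi subrr.
have := etrans (esym (diffBE u Ld_diff Psi_diff))
  (tangent_diff_eq0 (differentiableB Ld_diff Psi_diff) vanish tan_u).
have comp_diff := diff_compE u Lu_diff (Psibar_diff (Lu p)).
move=> /eqP; rewrite subr_eq0 => /eqP dLd.
have := etrans dLd comp_diff.
by rewrite (diff_linear_mx Ld) (diff_linear_mx Lu).
Qed.

Lemma wdot_Cmx_tangent_gt0 X p u : tangent_space (Psi @` X) p u -> u != 0 ->
  0 < wdot (Cmx R d m) u u.
Proof.
move=> tan_u u0; rewrite lt_neqAle wdot_Cmx_ge0 andbT eq_sym.
apply: contra_neq u0 => /wdot_Cmx_eq0 uu0.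
by rewrite -[u]vsubmxK (tangent_graph tan_u) uu0 linear0 col_mx0.
Qed.

(** The form does not depend on the point, so its coefficients in a chart are
    polynomials in the entries of the Jacobian matrix of the parametrization,
    which are continuous. *)
Lemma Cmx_induces_metric X : induces_metric (Cmx R d m) (Psi @` X).
Proof.
split=> [p _|U V S phi psi [_ [_ psiC] _ _ _] i j].
  split=> [u v _ _|a u v w _ _ _|u].
  - by rewrite !wdot_Cmx; apply: eq_bigr => i _; rewrite mulrC.
  - rewrite !wdot_Cmx mulr_sumr -big_split; apply: eq_bigr => i _ /=.
    by rewrite !mxE mulrDl mulrA.
  - exact: wdot_Cmx_tangent_gt0.
apply: continuous_in_subspaceT => y /set_mem[/psiC[_ Dpsi] _].
under [X in continuous_at _ X]eq_fun do rewrite wdot_Cmx.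
have Dentry a b : {for y, continuous (fun z =>
    'd psi z (delta_mx b 0 : 'cV[R]_(d + m)) a 0)} by exact: continuous_diff_entry.
apply: cvg_big => [||k _].
- exact: add_continuous.
- exact: nbhs_filter.
- by apply: cvgM; [exact: nbhs_filter|exact: Dentry|exact: Dentry].
Qed.

Lemma closest_points_Cmx X z : (Psi @` X) (coord_proj Psi z) ->
  closest_points (Cmx R d m) (Psi @` X) z = [set coord_proj Psi z].
Proof.
move=> Mz.
have wn0 : wnorm (Cmx R d m) (z - coord_proj Psi z) = 0.
  rewrite /wnorm wdot_Cmx big1 ?sqrtr0// => i _.
  by rewrite !mxE (unsplitK (inl i)) !mxE subrr mul0r.
apply/seteqP; split=> [p [[x Xx <-] /(_ _ Mz)]|_ ->] /=; last first.
  by split=> // q _; rewrite wn0 sqrtr_ge0.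
rewrite wn0 le_eqVlt ltNge sqrtr_ge0 orbF sqrtr_eq0 => w0.
have /wdot_Cmx_eq0 : wdot (Cmx R d m) (z - Psi x) (z - Psi x) = 0.
  by apply: le_anti; rewrite w0 wdot_Cmx_ge0.
rewrite linearB /= usubmx_Psi => /eqP; rewrite subr_eq0 => /eqP zx.
by rewrite /coord_proj zx -Psi_coord.
Qed.

End graph.

Theorem proposition6 (R : realType) (d m : nat)
    (X : set 'cV[R]_d) (X_compact : compact X)
    (eta : R) (eta_gt0 : 0 < eta)
    (Psi : 'cV[R]_d -> 'cV[R]_(d + m))
    (Psi_L2 : forall i, in_L2 (thickening X eta) (fun x => Psi x i 0))
    (Psi_indep : lin_indep_L2 (thickening X eta) Psi)
    (Psi_coord : contains_coordinates Psi)
    (Psibar_C1 : C1_on setT (Psibar Psi))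
    (M_manifold : embedded_manifold (Psi @` X)) :
  [/\ sym_psd (Cmx R d m),
      forall x, X x -> \det ((Dmx Psi x)^T *m Cmx R d m *m Dmx Psi x) != 0,
      induces_metric (Cmx R d m) (Psi @` X)
    & forall z, (Psi @` X) (coord_proj Psi z) ->
        closest_points (Cmx R d m) (Psi @` X) z = [set coord_proj Psi z]].
Proof.
have Psibar_diff x : differentiable (Psibar Psi) x by have [] := Psibar_C1 x I.
split.
- exact: sym_psd_Cmx.
- move=> x _; rewrite gram_Cmx usubmx_Dmx_Psi// trmx1 mulmx1 det1.
  exact: oner_neq0.
- exact: Cmx_induces_metric.
- by move=> z; exact: closest_points_Cmx.
Qed.
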